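(* Let $d$ be a positive even integer and $i$ a positive integer. Then $(-1)^{i-1}C_i^{(d)}$ equals the number of binary strings of length $\frac{d}{2}+1+\frac{d(i-1)}{2}$ containing exactly $\frac{d}{2}+1$ entries equal to $1$, such that for each of the first $i-1$ entries equal to $1$ (in left-to-right order), fewer than $\frac{d}{2}$ consecutive $0$s immediately precede it. Here \[ C_i^{(d)}=\sum_{k=0}^{i-1}\binom{i-1}{k}(-1)^k\frac{\Gamma\left(\frac{d}{2}(k+1)+2\right)}{\Gamma\left(\frac{d}{2}+2\right)\Gamma\left(1+\frac{dk}{2}\right)}. \] *)

(* Defs.v *)
From mathcomp Require Import all_boot all_order all_algebra.
From mathcomp Require Import all_classical all_reals all_analysis.

Set Implicit Arguments.
Unset Strict Implicit.
Unset Printing Implicit Defensive.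

Import Order.TTheory GRing.Theory Num.Theory.

Local Open Scope ring_scope.

(* Euler's Gamma function; the Lebesgue integral is real-valued and agrees with
   the usual improper integral for 0 < x, the only arguments used here. *)
Definition Gamma (R : realType) (x : R) : R :=
  \int[@lebesgue_measure R]_(t in `]0, +oo[%classic) (t `^ (x - 1) * expR (- t)).

(* C_i^{(d)}, for 1 <= i. *)
Definition Ccoef (R : realType) (d i : nat) : R :=
  \sum_(0 <= k < i)
    'C(i - 1, k)%:R * (-1) ^+ k *
    (Gamma (d%:R / 2 * (k%:R + 1) + 2) /
     (Gamma (d%:R / 2 + 2) * Gamma (1 + d%:R * k%:R / 2))).

(* Binary strings are sequences of booleans, with true standing for 1. *)
Definition ones_positions (s : seq bool) : seq nat :=
  [seq p <- iota 0 (size s) | nth false s p].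

(* Length of the maximal block of 0s ending just before position p. *)
Definition zeros_before (s : seq bool) (p : nat) : nat :=
  find id (rev (take p s)).

(* The first n entries equal to 1 exist, and each of them is immediately
   preceded by fewer than m consecutive 0s.  The existence clause matters when
   n exceeds the number of 1s: no string then qualifies. *)
Definition short_gaps (m n : nat) (s : seq bool) : bool :=
  (n <= size (ones_positions s))%N &&
  all (fun p => zeros_before s p < m)%N (take n (ones_positions s)).

(* Main.v *)
Require Import Defs.
From mathcomp Require Import all_boot all_order all_algebra.
From mathcomp Require Import all_classical all_reals all_analysis.
From mathcomp Require Import measurable_realfun zify ring.

Set Implicit Arguments.
Unset Strict Implicit.
Unset Printing Implicit Defensive.

Import Order.TTheory GRing.Theory Num.Theory.

Local Open Scope ring_scope.

(* With [m = d/2] and [Gamma (n + 1) = n!], the [k]-th term of [Ccoef] is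
   ['C(n, k) (-1)^k 'C(m + 1 + k m, m + 1)], [n = i - 1], so [(-1)^n Ccoef] is
   the [n]-th finite difference of [L |-> 'C(L, m + 1)], with step [m].  On the
   other side, removing [m] zeros in front of the [(n+1)]-st 1 shows that the
   numbers [f n L] of strings of length [L] whose first [n] gaps are short
   satisfy [f n.+1 (L + m) = f n (L + m) - f n L], and [f 0 L = 'C(L, m + 1)]. *)

(** * Binary strings listed by first letter *)

Fixpoint bitstrings (L : nat) : seq bitseq :=
  if L is L'.+1 then
    [seq true :: s | s <- bitstrings L'] ++ [seq false :: s | s <- bitstrings L']
  else [:: [::]].

Lemma mem_bitstrings L s : (s \in bitstrings L) = (size s == L).
Proof.
elim: L s => [|L IH] [|b s] //=; rewrite mem_cat.
  by apply/negP => /orP[] /mapP[].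
rewrite eqSS -IH; have inj (c : bool) : injective (cons c) by move=> ? ? [].
have notin c t : ((~~ c) :: t \in [seq c :: s | s <- bitstrings L]) = false.
  by apply/negP => /mapP[u _ []]; case: c.
case: b; first by rewrite (mem_map (inj true)) (notin false) orbF.
by rewrite (mem_map (inj false)) (notin true).
Qed.

Lemma bitstrings_uniq L : uniq (bitstrings L).
Proof.
elim: L => //= L IH; have inj (c : bool) : injective (cons c) by move=> ? ? [].
rewrite cat_uniq !map_inj_uniq ?IH ?andbT //=.
by apply/hasPn => _ /mapP[s _ ->]; apply/negP => /mapP[].
Qed.

(** Passes from tuples to an explicit list, where counts obey a recursion on the first letter. *)
Lemma card_tuple_bool L (P : pred bitseq) :
  #|[pred s : L.-tuple bool | P s]| = count P (bitstrings L).
Proof.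
rewrite cardE -size_filter -(size_map val); apply/perm_size/uniq_perm.
- by rewrite map_inj_uniq ?enum_uniq //; exact: val_inj.
- exact/filter_uniq/bitstrings_uniq.
move=> s; rewrite mem_filter mem_bitstrings; apply/mapP/andP.
  by case=> t; rewrite mem_enum inE => Pt ->; rewrite size_tuple.
by case=> Ps sL; exists (Tuple sL); rewrite // mem_enum inE.
Qed.

(** * The gap condition as a left-to-right scan *)

(* The scan form of [short_gaps]: [z] zeros are pending on the left of [s], and
   [n] ones of [s] remain constrained. *)
Fixpoint gaps_lt (m z n : nat) (s : bitseq) : bool :=
  match s with
  | [::] => n == 0%N
  | true :: s' => ((n == 0%N) || (z < m)%N) && gaps_lt m 0 n.-1 s'
  | false :: s' => gaps_lt m z.+1 n s'
  end.

Lemma ones_positions_cons b s :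
  ones_positions (b :: s) =
  if b then 0%N :: map S (ones_positions s) else map S (ones_positions s).
Proof.
rewrite /ones_positions /= (iotaDl 1 0) filter_map.
by rewrite (@eq_filter _ _ (nth false s)).
Qed.

(** The prefix [u] is the part already scanned: positions shift by [size u], and only its trailing
    zeros affect the rest. *)
Lemma gaps_ltP m n u s :
  (n <= size (ones_positions s))%N &&
    all (fun p => zeros_before (u ++ s) (size u + p) < m)%N
      (take n (ones_positions s)) =
  gaps_lt m (find id (rev u)) n s.
Proof.
elim: s n u => [|b s IH] n u; first by rewrite /= leqn0 andbT.
have shift k : all (fun p => zeros_before (u ++ b :: s) (size u + p) < m)%N
      (take k (map S (ones_positions s))) =
    all (fun p => zeros_before (rcons u b ++ s) (size (rcons u b) + p) < m)%N
      (take k (ones_positions s)).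
  rewrite -map_take all_map; apply: eq_all => p /=.
  by rewrite cat_rcons size_rcons addnS.
rewrite ones_positions_cons; case: b shift => shift /=; last first.
  by rewrite size_map shift IH rev_rcons.
case: n => [|n]; first by rewrite take0 /= -[RHS](IH 0%N [::]) take0.
rewrite /= ltnS size_map shift andbCA IH rev_rcons /= addn0.
by rewrite /zeros_before take_size_cat.
Qed.

Lemma short_gapsE m n s : short_gaps m n s = gaps_lt m 0 n s.
Proof. exact: (gaps_ltP m n [::] s). Qed.

(** * Recurrences for strings with short gaps *)

Definition gap_count (m z n q L : nat) : nat :=
  count (fun s => (count_mem true s == q) && gaps_lt m z n s) (bitstrings L).

Lemma gap_count0 m z n q : gap_count m z n q 0 = (q == 0%N) && (n == 0%N) :> nat.
Proof. by rewrite /gap_count /= addn0 eq_sym. Qed.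

Lemma gap_countS m z n q L :
  gap_count m z n q L.+1 =
  ((if q is q'.+1 then ((n == 0) || (z < m)) * gap_count m 0 n.-1 q' L else 0)
   + gap_count m z.+1 n q L)%N.
Proof.
rewrite /gap_count /= count_cat !count_map; congr (_ + _)%N.
case: q => [|q]; first by rewrite (eq_count (a2 := pred0)) ?count_pred0.
case E: ((n == 0%N) || (z < m)%N).
  by rewrite mul1n; apply: eq_count => s /=; rewrite E add1n eqSS.
by rewrite (eq_count (a2 := pred0)) ?count_pred0 // => s /=; rewrite E andbF.
Qed.

Lemma gap_count_free m z q L : gap_count m z 0 q L = 'C(L, q).
Proof.
elim: L z q => [|L IH] z q; first by rewrite gap_count0 andbT; case: q.
rewrite gap_countS IH; case: q => [|q]; first by rewrite !bin0.
by rewrite IH mul1n binS addnC.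
Qed.

(** Pending zeros only accumulate, so the next 1 breaks the bound, and a string without 1s fails
    because a 1 is still required. *)
Lemma gap_count_blocked m z n q L :
  (m <= z)%N -> gap_count m z n.+1 q L = 0%N.
Proof.
elim: L z => [|L IH] z mz; first by rewrite gap_count0 andbF.
rewrite gap_countS IH ?(leq_trans mz) // addn0.
by case: {IH} q => // q; rewrite ltnNge mz.
Qed.

(* Here [z = m - k] zeros are pending, so the first gap is too long exactly when
   the string starts with [k] zeros. *)
Lemma gap_count_first m k q L : (k <= m)%N ->
  (gap_count m (m - k) 1 q (L + k) + 'C(L, q) = 'C(L + k, q))%N.
Proof.
elim: k => [|k IH] km; first by rewrite subn0 addn0 gap_count_blocked.
rewrite addnS gap_countS -subSn // subSS -addnA (IH (ltnW km)).
case: {IH} q => [|q]; first by rewrite !bin0.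
by rewrite leq_subr gap_count_free binS mul1n addnC.
Qed.

(* Strings whose first [n] gaps are short and whose [(n+1)]-st gap is not are
   those obtained by lengthening that gap by [m].  For [n >= q] there is no such
   gap, and the bound on [L] is what makes the identity hold. *)
Lemma gap_count_rec m z n q L : (0 < n)%N -> (n * m <= L + z)%N ->
  (gap_count m z n.+1 q (L + m) + gap_count m z n q L
   = gap_count m z n q (L + m))%N.
Proof.
elim: L z n q => [|L IH] z [//|n] q _ Lz.
  (* For [L = 0] the length bound gives [m <= z], so all three counts vanish. *)
  by rewrite !gap_count_blocked //; move: Lz; rewrite mulSn; lia.
rewrite addSn !gap_countS addnACA IH //; last by rewrite addnS -addSn.
congr addn; case: q => // q; rewrite !orFb /=.
case: (ltnP z m) => zm; rewrite ?mul0n // !mul1n.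
(* A leading 1 resets [z] to 0; as [z < m], the length bound survives with one gap fewer. *)
case: n Lz => [|n] Lz; last by apply: IH => //; move: Lz; rewrite !mulSn; lia.
by rewrite !gap_count_free -{1}(subnn m) gap_count_first.
Qed.

Lemma gap_count_step m n q L : (n * m <= L)%N ->
  (gap_count m 0 n.+1 q (L + m) + gap_count m 0 n q L
   = gap_count m 0 n q (L + m))%N.
Proof.
case: n => [|n] nL; last by apply: gap_count_rec; rewrite ?addn0.
by rewrite !gap_count_free -{1}(subnn m) gap_count_first.
Qed.

(** * Iterated finite differences *)

(** Pascal's rule and a shift of the index trade one order of the sum for one difference of [a]. *)
Lemma alternating_binomial_sumS (R : pzRingType) (a : nat -> R) n :
  \sum_(k < n.+2) 'C(n.+1, k)%:R * (-1) ^+ k * a k =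
  \sum_(k < n.+1) 'C(n, k)%:R * (-1) ^+ k * (a k - a k.+1).
Proof.
under [RHS]eq_bigr do rewrite mulrBr.
rewrite sumrB big_ord_recl.
under eq_bigr do rewrite lift0 binS natrD !mulrDl.
rewrite big_split addrA; congr (_ + _).
  rewrite big_ord_recr [in RHS]big_ord_recl /= (@bin_small n n.+1) //.
  by rewrite !mul0r addr0 !bin0; congr (_ + _); apply: eq_bigr.
by rewrite -sumrN; apply: eq_bigr => k _; rewrite exprS mulN1r mulrN mulNr.
Qed.

(** Iterates [gap_count_step]; the length [L + n * m] meets its bound at each stage. *)
Lemma gap_count_alternating_sum (R : pzRingType) m n q L :
  (gap_count m 0 n q (L + n * m))%:R =
  (-1) ^+ n * \sum_(k < n.+1) 'C(n, k)%:R * (-1) ^+ k * 'C(L + k * m, q)%:R :> R.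
Proof.
elim: n L => [|n IH] L.
  by rewrite big_ord1 gap_count_free !mul1r.
rewrite (alternating_binomial_sumS (fun k => 'C(L + k * m, q)%:R)).
under eq_bigr do rewrite mulrBr.
rewrite sumrB mulrBr exprS -!mulrA !mulN1r opprK -IH.
have -> : \sum_(k < n.+1) 'C(n, k)%:R * (-1) ^+ k * 'C(L + k.+1 * m, q)%:R =
          \sum_(k < n.+1) 'C(n, k)%:R * (-1) ^+ k * 'C((L + m) + k * m, q)%:R :> R.
  by apply: eq_bigr => k _; rewrite mulSn addnA.
rewrite -IH; have := @gap_count_step m n q (L + n * m) (leq_addl _ _).
rewrite mulSn (addnC m) addnA (addnAC L m) => <-.
by rewrite natrD addrC addrK.
Qed.

(** * The Gamma function at positive integers *)

Import numFieldNormedType.Exports.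
Local Open Scope classical_set_scope.

(** The exponential dominates its Taylor term of degree [n.+1], so for x > 0 the product is at most
    (n+1)!/x. *)
Lemma exprM_expRN_cvgy (R : realType) n :
  x ^+ n * expR (- x) @[x --> +oo] --> (0 : R).
Proof.
apply/cvgrPdist_lt => e e0; near=> x.
have x0 : 0 < x by near: x; exact: nbhs_pinfty_gt.
rewrite sub0r normrN ger0_norm ?mulr_ge0 ?exprn_ge0 ?expR_ge0 ?ltW //.
rewrite expRN ltr_pdivrMr ?expR_gt0 //.
have le1 : x ^+ n.+1 / n.+1`!%:R <= expR x.
  by apply: le_trans (expR_ge1Dxn n (ltW x0)); rewrite lerDr.
apply: lt_le_trans (ler_wpM2l (ltW e0) le1).
rewrite exprSr -mulrA mulrCA ltr_pMr ?exprn_gt0 // mulrA mulrAC.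
rewrite -ltr_pdivrMl ?divr_gt0 //.
by rewrite mulr1 invf_div; near: x; apply: nbhs_pinfty_gt; exact: num_real.
Unshelve. all: by end_near. Qed.

(** Repeated integration by parts yields the antiderivative of [x ^+ n * expR (- x)] that vanishes
    at infinity: minus the upper incomplete Gamma function of parameter n + 1. *)
Fixpoint gamma_primitive (R : realType) n (x : R) : R :=
  if n is n'.+1 then n%:R * gamma_primitive n' x - x ^+ n * expR (- x)
  else - expR (- x).

Lemma is_derive_expRN (R : realType) (x : R) :
  is_derive x 1 (fun y => expR (- y)) (- expR (- x)).
Proof. by rewrite -mulrN1; exact: is_derive1_comp. Qed.

Lemma is_derive_exprM_expRN (R : realType) n (x : R) :
  is_derive x 1 (fun y => y ^+ n * expR (- y))
    (n%:R * x ^+ n.-1 * expR (- x) - x ^+ n * expR (- x)).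
Proof.
have dX : is_derive x 1 (fun y : R => y ^+ n) (n%:R * x ^+ n.-1).
  by apply: DeriveDef; [exact: exprn_derivable | rewrite exp_derive [LHS]mulr1].
have -> : n%:R * x ^+ n.-1 * expR (- x) - x ^+ n * expR (- x) =
    x ^+ n *: (- expR (- x)) + expR (- x) *: (n%:R * x ^+ n.-1).
  by rewrite /GRing.scale /=; ring.
exact: (is_deriveM dX (is_derive_expRN x)).
Qed.

Lemma is_derive_gamma_primitive (R : realType) n (x : R) :
  is_derive x 1 (gamma_primitive n) (x ^+ n * expR (- x)).
Proof.
elim: n => [|n IH].
  rewrite mul1r -[X in is_derive _ _ _ X]opprK.
  exact: (is_deriveN (is_derive_expRN x)).
have -> : x ^+ n.+1 * expR (- x) = n.+1%:R *: (x ^+ n * expR (- x)) -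
    (n.+1%:R * x ^+ n * expR (- x) - x ^+ n.+1 * expR (- x)).
  by rewrite /GRing.scale /=; ring.
exact: (is_deriveB (is_deriveZ n.+1%:R IH) (is_derive_exprM_expRN n.+1 x)).
Qed.

Lemma gamma_primitive0 (R : realType) n : gamma_primitive n (0 : R) = - n`!%:R.
Proof.
elim: n => [|n IH] /=; first by rewrite oppr0 expR0.
by rewrite IH expr0n mul0r subr0 mulrN -natrM.
Qed.

Lemma gamma_primitive_cvgy (R : realType) n :
  gamma_primitive n x @[x --> +oo] --> (0 : R).
Proof.
elim: n => [|n IH]; first by rewrite -oppr0; apply: cvgN; exact: cvgr_expR.
rewrite -[0](subrr 0) -{1}(mulr0 n.+1%:R).
by apply: cvgB (exprM_expRN_cvgy n.+1); exact: cvgMl_tmp.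
Qed.

Lemma Gamma_natS (R : realType) n : Gamma (n%:R + 1 : R) = n`!%:R.
Proof.
have cont (F df : R -> R) :
    (forall x : R, is_derive x 1 F (df x)) -> continuous F.
  move=> dF x; apply/differentiable_continuous/derivable1_diffP.
  by have [] := dF x.
have fc := cont _ _ (is_derive_exprM_expRN n).
transitivity (\int[@lebesgue_measure R]_(x in `]0, +oo[) (x ^+ n * expR (- x))).
  rewrite /Gamma addrK; apply: eq_Rintegral => x.
  by rewrite inE /= in_itv /= andbT => x0; rewrite powR_mulrn ?ltW.
(* The endpoint 0 is a null set; adding it lets the fundamental theorem of calculus apply on the
   closed half-line. *)
transitivity (\int[@lebesgue_measure R]_(x in `[0, +oo[) (x ^+ n * expR (- x))).
  rewrite /Rintegral integral_itv_obnd_cbnd //.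
  by apply/measurable_EFinP/measurable_funTS; exact: continuous_measurable_fun.
rewrite (@Rintegral_ge0_continuous_FTC2y R _ (gamma_primitive n) _ 0).
- by rewrite gamma_primitive0 sub0r opprK.
- by move=> x x0; rewrite mulr_ge0 ?exprn_ge0 ?expR_ge0.
- exact: continuous_subspaceT fc.
- exact: gamma_primitive_cvgy.
- by move=> x _; have [] := is_derive_gamma_primitive n x.
- apply: cvg_at_right_filter; exact: cont (is_derive_gamma_primitive n) 0.
- by move=> x _; rewrite derive1E; have [] := is_derive_gamma_primitive n x.
Qed.

Local Close Scope classical_set_scope.

(** * Evaluation of the coefficient *)

(** Every Gamma argument is a positive integer, so each quotient is one of factorials and equals a
    binomial coefficient. *)
Lemma Ccoef_double (R : realType) m n :
  Ccoef R m.*2 n.+1 =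
  \sum_(k < n.+1) 'C(n, k)%:R * (-1) ^+ k * 'C(m.+1 + k * m, m.+1)%:R.
Proof.
rewrite /Ccoef subn1 big_mkord; apply: eq_bigr => k _; congr (_ * _).
have half : m.*2%:R / 2 = m%:R :> R by rewrite -muln2 natrM mulfK ?pnatr_eq0.
rewrite half (mulrAC _ k%:R) half.
have -> : m%:R * (k%:R + 1) + 2 = (m.+1 + k * m)%:R + 1 :> R.
  by rewrite natrD natrM -natr1; ring.
have -> : m%:R + 2 = m.+1%:R + 1 :> R by rewrite -natr1; ring.
have -> : 1 + m%:R * k%:R = (k * m)%:R + 1 :> R by rewrite natrM; ring.
rewrite !Gamma_natS -(bin_fact (leq_addr (k * m) m.+1)) addKn -natrM natrM.
by rewrite mulfK // pnatr_eq0 -lt0n muln_gt0 !fact_gt0.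
Qed.

Theorem mainTheorem6 (R : realType) (d i : nat)
    (hd : (0 < d)%N) (d_even : ~~ odd d) (hi : (0 < i)%N) :
  (-1) ^+ (i - 1) * Ccoef R d i =
  #|[set s : (d %/ 2 + 1 + d * (i - 1) %/ 2).-tuple bool
      | (count_mem true s == d %/ 2 + 1)%N && short_gaps (d %/ 2) (i - 1) s]|%:R.
Proof.
case: i hi => // n _; rewrite subn1 /=.
have -> : d = (d./2).*2 by rewrite even_halfK.
set m := d./2; rewrite Ccoef_double -gap_count_alternating_sum.
(* The division is exact, so the string length takes the form [m.+1 + n * m]. *)
have -> : (m.*2 * n %/ 2 = n * m)%N by rewrite -muln2 mulnAC mulnK // mulnC.
rewrite divn2 doubleK addn1; congr _%:R.
rewrite /gap_count -card_tuple_bool; apply: eq_card => s.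
by rewrite !inE short_gapsE.
Qed.
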